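(* Let $w$ be a (self-avoiding) bridge on the square lattice $\mathbb{Z}^2$, with height given by the ordinate. Then $w$ is weakly directed if and only if each of its irreducible bridges is partially directed (that is, avoids at least one of the steps N, E, S, W). In fact, this means that each of its irreducible bridges is a NES-walk or a NSW-walk; i.e. the following three conditions on the bridge $w$ are equivalent: (1) $w$ is weakly directed; (2) each irreducible bridge in the factorization of $w$ is partially directed; (3) each irreducible bridge in the factorization of $w$ is a NES-walk or a NSW-walk.
   Context: The square lattice steps are N$=(0,1)$, E$=(1,0)$, S$=(0,-1)$, W$=(-1,0)$. A walk is a finite sequence of vertices $v_0,\dots,v_n$ of $\mathbb{Z}^2$ in which each $v_i-v_{i-1}$ is one of these steps. All walks are self-avoiding (no vertex is visited twice) and are considered up to translation. For a set $\mathcal S$ of steps, an $\mathcal S$-walk is a self-avoiding walk all of whose steps lie in $\mathcal S$ (e.g. a NES-walk uses only steps N, E, S). A walk is partially directed if it avoids at least one of the four steps. The height $h(v)$ of a vertex $v$ is its ordinate. A walk is weakly directed if, between two visits to any given horizontal line, the walk is partially directed: whenever $i<j$ and $h(v_i)=h(v_j)$, the portion $v_i,\dots,v_j$ avoids at least one of the steps N, E, S, W. A walk $v_0\cdots v_n$ is a bridge if all its vertices $v\neq v_n$ satisfy $h(v_0)\le h(v)<h(v_n)$. The concatenation of two bridges is a bridge. An irreducible bridge is a nonempty bridge that is not the concatenation of two nonempty bridges. Every bridge factors uniquely as a sequence of irreducible bridges; these are ''its irreducible bridges''. *)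

(* Defs.v *)
From HB Require Import structures.
From mathcomp Require Import all_boot all_order all_algebra.

Set Implicit Arguments.
Unset Strict Implicit.
Unset Printing Implicit Defensive.

Import Order.TTheory GRing.Theory Num.Theory.
Local Open Scope ring_scope.

Inductive step := North | East | South | West.

Definition step_code (s : step) : 'I_4 :=
  match s with
  | North => inord 0 | East => inord 1 | South => inord 2 | West => inord 3
  end.

Definition step_decode (i : 'I_4) : step := nth West [:: North; East; South] i.

Lemma step_codeK : cancel step_code step_decode.
Proof. by case; rewrite /step_decode /step_code inordK. Qed.

HB.instance Definition _ := Finite.copy step (can_type step_codeK).

Definition step_vec (s : step) : int * int :=
  match s with
  | North => (0, 1) | East => (1, 0) | South => (0, -1) | West => (-1, 0)
  end.

(* Walks are taken up to translation, so a walk v_0 ... v_n is encoded by the *)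
(* sequence of its n steps v_i - v_(i-1); its vertices are those of the       *)
(* representative starting at the origin. Concatenation of walks is then      *)
(* [cat], and the portion v_i ... v_j of w is [drop i (take j w)].            *)
Definition walk := seq step.

(* Meaningful for i <= size w. *)
Definition vertex (w : walk) (i : nat) : int * int :=
  \sum_(s <- take i w) step_vec s.

Definition vertices (w : walk) : seq (int * int) :=
  [seq vertex w i | i <- iota 0 (size w).+1].

Definition height (w : walk) (i : nat) : int := (vertex w i).2.

Definition self_avoiding (w : walk) : bool := uniq (vertices w).

Definition walk_over (A : seq step) (w : walk) : bool :=
  self_avoiding w && all [in A] w.

Definition NES_walk : walk -> bool := walk_over [:: North; East; South].
Definition NSW_walk : walk -> bool := walk_over [:: North; South; West].

Definition partially_directed (w : walk) : Prop := exists s : step, s \notin w.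

Definition weakly_directed (w : walk) : Prop :=
  forall i j : nat, (i < j <= size w)%N -> height w i = height w j ->
  partially_directed (drop i (take j w)).

(* The empty walk (a single vertex) is a bridge. *)
Definition bridge (w : walk) : bool :=
  self_avoiding w &&
  [forall i : 'I_(size w), height w 0 <= height w i < height w (size w)].

Definition irreducible_bridge (w : walk) : Prop :=
  [/\ bridge w, w <> [::] &
   ~ exists w1 w2 : walk,
       [/\ bridge w1, bridge w2, w1 <> [::], w2 <> [::] & w = w1 ++ w2]].

Definition irreducible_factorization (w : walk) (bs : seq walk) : Prop :=
  (forall b : walk, b \in bs -> irreducible_bridge b) /\ flatten bs = w.

Lemma vertex_cat_l a b i : (i <= size a)%N -> vertex (a ++ b) i = vertex a i.
Proof. by move=> le_i; rewrite /vertex takel_cat. Qed.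

Lemma vertex_cat_r a b i :
  vertex (a ++ b) (size a + i) = vertex a (size a) + vertex b i.
Proof.
by rewrite /vertex take_size take_cat ltnNge leq_addr addKn big_cat.
Qed.

Lemma height_cat_l a b i : (i <= size a)%N -> height (a ++ b) i = height a i.
Proof. by move=> le_i; rewrite /height vertex_cat_l. Qed.

Lemma height_cat_r a b i :
  height (a ++ b) (size a + i) = height a (size a) + height b i.
Proof. by rewrite /height vertex_cat_r. Qed.

Lemma height0 w : height w 0 = 0.
Proof. by rewrite /height /vertex take0 big_nil. Qed.

Lemma bridgeP w :
  reflect (self_avoiding w /\
    forall i, (i < size w)%N -> 0 <= height w i < height w (size w)) (bridge w).
Proof.
apply: (iffP andP) => -[-> H]; split=> //.
  by move=> i lt_i; have /forallP/(_ (Ordinal lt_i)) := H; rewrite height0.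
by apply/forallP => i; rewrite height0 H.
Qed.

Lemma self_avoiding_catr a b : self_avoiding (a ++ b) -> self_avoiding b.
Proof.
rewrite /self_avoiding /vertices size_cat -addnS iotaD map_cat cat_uniq.
case/and3P=> _ _; rewrite add0n -[X in iota X]addn0 iotaDl -map_comp.
rewrite (eq_map (g := [eta +%R (vertex a (size a))] \o vertex b)).
  by rewrite map_comp map_inj_uniq //; apply: addrI.
by move=> i /=; rewrite vertex_cat_r.
Qed.

Lemma height_flatten_ge0 bs i : (forall b, b \in bs -> bridge b) ->
  (i <= size (flatten bs))%N -> 0 <= height (flatten bs) i.
Proof.
elim: bs i => [|b bs IH] i Hb /=.
  by rewrite leqn0 => /eqP ->; rewrite height0.
have /bridgeP[_ Hbr] : bridge b by apply: Hb; rewrite mem_head.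
have ge0 : 0 <= height b (size b).
  case: (posnP (size b)) => [->|/Hbr]; first by rewrite height0.
  by rewrite height0 lexx => /ltW.
rewrite size_cat => le_i; case: (ltnP i (size b)) => [lt_ib|le_bi].
  by rewrite height_cat_l ?(ltnW lt_ib)//; case/andP: (Hbr _ lt_ib).
rewrite -(subnKC le_bi) height_cat_r addr_ge0 ?IH //; last by rewrite leq_subLR.
by move=> c Hc; apply: Hb; rewrite inE Hc orbT.
Qed.

Lemma bridge_factorization_exists w :
  bridge w -> exists bs, irreducible_factorization w bs.
Proof.
have [n] := ubnP (size w); elim: n w => // n IH w lt_w Hw.
case: (eqVneq w [::]) => [->|nz]; first by exists [::].
pose P k := bridge (take k w) && bridge (drop k w).
have [/hasP[k]|noP] := boolP (has P (iota 1 (size w).-1)); last first.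
  exists [:: w]; split; last by rewrite /= cats0.
  move=> b; rewrite inE => /eqP ->; split=> //; first exact/eqP.
  case=> w1 [w2 [B1 B2 nz1 nz2 Ew]]; case/negP: noP; apply/hasP.
  have s1 : (0 < size w1)%N by case: (w1) nz1.
  have s2 : (0 < size w2)%N by case: (w2) nz2.
  exists (size w1); last by rewrite /P Ew take_size_cat // drop_size_cat // B1.
  rewrite mem_iota s1 Ew size_cat add1n prednK ?addn_gt0 ?s1 //.
  by rewrite -[X in (X < _)%N]addn0 ltn_add2l.
have sw : (0 < size w)%N by rewrite lt0n size_eq0.
rewrite mem_iota add1n prednK // => /andP[k0 kw] /andP[B1 B2].
have [|bs1 [H1 E1]] := IH _ _ B1.
  by rewrite size_takel ?(ltnW kw) // (leq_trans kw).
have [|bs2 [H2 E2]] := IH _ _ B2.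
  rewrite size_drop; apply: leq_trans (lt_w : (size w <= n)%N).
  by rewrite -[X in (_ < X)%N]subn0 ltn_sub2l.
exists (bs1 ++ bs2); split; last by rewrite flatten_cat E1 E2 cat_take_drop.
by move=> b; rewrite mem_cat => /orP[/H1|/H2].
Qed.

Lemma irreducible_bridge_head_le b c s bs :
  irreducible_bridge b -> irreducible_bridge c ->
  (forall x, x \in bs -> irreducible_bridge x) ->
  b ++ flatten bs = c ++ s -> (size c <= size b)%N.
Proof.
move=> [Bb nzb _] [Bc nzc irc] Hbs E; rewrite leqNgt; apply/negP => lt_bc.
set d := drop (size b) c.
have Ec : c = b ++ d.
  rewrite -[LHS](cat_take_drop (size b)); congr (_ ++ _).
  by have := congr1 (take (size b)) E; rewrite take_size_cat // takel_cat ?(ltnW lt_bc).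
have Ed : flatten bs = d ++ s.
  by have := congr1 (drop (size b)) E; rewrite drop_size_cat // Ec -catA drop_size_cat.
apply: irc; exists b, d; split=> //; last first.
  by move=> d0; move: lt_bc; rewrite Ec d0 cats0 ltnn.
have /bridgeP[SAc Hc] := Bc.
apply/bridgeP; split; first by apply: (@self_avoiding_catr b); rewrite -Ec.
move=> i lt_i; apply/andP; split.
  rewrite -(@height_cat_l d s) ?(ltnW lt_i) // -Ed.
  apply: height_flatten_ge0 => [x /Hbs[]//|].
  by rewrite Ed size_cat (leq_trans (ltnW lt_i)) ?leq_addr.
have := Hc (size b + i)%N; rewrite Ec size_cat ltn_add2l !height_cat_r.
by move=> /(_ lt_i) /andP[_]; rewrite ltrD2l.
Qed.

Lemma bridge_factorization_unique w bs1 bs2 :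
  irreducible_factorization w bs1 -> irreducible_factorization w bs2 ->
  bs1 = bs2.
Proof.
case=> H1 <- [H2] /esym; elim: bs1 bs2 H1 H2 => [|b bs1 IH] [|c bs2] //= H1 H2.
- by case: c H2 => // /(_ [::] (mem_head _ _)) [].
- by case: b H1 => // /(_ [::] (mem_head _ _)) [].
have Hb := H1 b (mem_head _ _); have Hc := H2 c (mem_head _ _).
have T1 x : x \in bs1 -> irreducible_bridge x.
  by move=> Hx; apply: H1; rewrite inE Hx orbT.
have T2 x : x \in bs2 -> irreducible_bridge x.
  by move=> Hx; apply: H2; rewrite inE Hx orbT.
move=> E; have /eqP Es : size b == size c.
  rewrite eqn_leq (irreducible_bridge_head_le Hc Hb T2 (esym E)).
  exact: irreducible_bridge_head_le Hb Hc T1 E.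
by move/eqP: E; rewrite eqseq_cat // => /andP[/eqP -> /eqP /(IH _ T1 T2) ->].
Qed.

(* Hence "the irreducible bridges of w" are well defined. *)
Lemma bridge_factorization w :
  bridge w -> exists! bs, irreducible_factorization w bs.
Proof.
move=> /bridge_factorization_exists[bs Hbs]; exists bs; split=> // bs'.
exact: bridge_factorization_unique.
Qed.

(* Main.v *)
Require Import Defs.
From mathcomp Require Import all_boot all_order all_algebra.
From mathcomp Require Import zify.

(** Everything rests on one fact ([irreducible_weakly_directed]): an
    irreducible bridge [b] that is weakly directed cannot use both E and W.

    Suppose it does.  Then [b] contains two opposite horizontal steps with only
    vertical steps between them ([opposite_horizontal_split]), and by
    self-avoidance those vertical steps form a nonempty run N^k or S^k.  Call a
    vertex early if it comes no later than the start of the first of these two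
    horizontal steps, and late if it comes no earlier than the end of the second
    one.  No height is visited both by an early and by a late vertex: the
    portion between the two would contain E and W, and also N and S since the
    run changes the height ([weakly_directed_no_return]).

    Heights vary by at most one along a step, so discrete continuity applies.
    A run S^k is impossible, because a bridge ends above all its other vertices
    and has to climb back to the height at which the run started.  For a run
    N^k, let z be the least height of the run that exceeds the heights of all
    the early vertices; z exists, for otherwise the height of the top of the run
    would be that of an early and of a late vertex.  The height z - 1 is visited
    by an early vertex, hence by no late one, and so the walk stays at height at
    least z after the run.  Thus [b] can be cut at the vertex of height z of the
    run into two nonempty bridges, contradicting irreducibility.

    A partially directed walk is obviously weakly directed, so the fact above
    turns both weak and partial directedness of an irreducible bridge into being
    a NES-walk or a NSW-walk.  Weak directedness passes to the factors of a
    walk; conversely it passes from the irreducible bridges to [w], because two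
    vertices of [w] with the same height belong to the same irreducible bridge
    ([weakly_directed_cat]). *)

Set Implicit Arguments.
Unset Strict Implicit.
Unset Printing Implicit Defensive.

Import Order.TTheory GRing.Theory Num.Theory.
Local Open Scope ring_scope.

(** * Steps and heights *)

(** Written as a match, rather than as membership in the list of E and W, so
    that it computes. *)
Definition horizontal (s : step) : bool :=
  if s is (East | West) then true else false.

Lemma horizontalE s : horizontal s = (s \in [:: East; West]).
Proof.
by rewrite !inE; case: s; rewrite ?eqxx ?orbT //=;
  apply/esym/norP; split; apply/eqP.
Qed.

Lemma perm_eq_East_West (d d' : step) : perm_eq [:: d; d'] [:: East; West] ->
  (d = East /\ d' = West) \/ (d = West /\ d' = East).
Proof.
move=> Pdd'; have : d \in [:: East; West] by rewrite -(perm_mem Pdd') mem_head.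
rewrite !inE => /orP[]/eqP Ed; [left | right]; move: Pdd'; rewrite Ed.
  by rewrite perm_cons => /perm_small_eq-/(_ isT) [].
move/perm_trans/(_ (permEl (perm_catC [:: East] [:: West]))).
by rewrite perm_cons => /perm_small_eq-/(_ isT) [].
Qed.

Lemma heightS w i : (i < size w)%N ->
  height w i.+1 = height w i + (step_vec (nth North w i)).2.
Proof.
move=> lt_i; rewrite /height /vertex (take_nth North lt_i) -cats1.
by rewrite big_cat big_seq1.
Qed.

(** Discrete continuity: all the heights from that of [v_i] up to that of [v_j]
    are visited between [v_i] and [v_j]. *)
Lemma height_ivt w i j (z : int) : (i <= j <= size w)%N ->
  height w i <= z <= height w j ->
  exists2 k, (i <= k <= j)%N & height w k = z.
Proof.
elim: j => [|j IH] Hij Hz.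
  by exists 0%N; move: Hij Hz; case: i => // _ /andP[H1 H2]; lia.
have [Ei|ne_i] := eqVneq i j.+1.
  by exists i; [lia | move: Hz; rewrite Ei; lia].
have [->|ne_z] := eqVneq z (height w j.+1); first by exists j.+1 => //; lia.
have HS : height w j.+1 <= height w j + 1.
  by rewrite heightS ?lerD2l; [case: (nth _ _ _) | lia].
have [||k Hk <-] := IH; [lia | lia |].
by exists k => //; lia.
Qed.

Lemma sum_step_le0 (s : walk) :
  North \notin s -> (\sum_(x <- s) step_vec x).2 <= 0.
Proof.
elim: s => [|x s IH]; first by rewrite big_nil.
rewrite inE negb_or big_cons -[(_ + _).2]/(_.2 + _.2) => /andP[+ /IH].
by case: x => /= [/eqP|_|_|_] //; lia.
Qed.

Lemma sum_step_ge0 (s : walk) :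
  South \notin s -> 0 <= (\sum_(x <- s) step_vec x).2.
Proof.
elim: s => [|x s IH]; first by rewrite big_nil.
rewrite inE negb_or big_cons -[(_ + _).2]/(_.2 + _.2) => /andP[+ /IH].
by case: x => /= [_|_|/eqP|_] //; lia.
Qed.

(** * Steps occurring between two vertices *)

Lemma height_portion w i j : (i <= j <= size w)%N ->
  height w j = height w i + (\sum_(s <- drop i (take j w)) step_vec s).2.
Proof.
case/andP=> le_ij le_j; rewrite /height /vertex.
by rewrite -{1}(cat_take_drop i (take j w)) big_cat take_takel.
Qed.

Lemma portion_North w i j : (i <= j <= size w)%N ->
  height w i < height w j -> North \in drop i (take j w).
Proof.
move=> /height_portion ->; apply: contraTT => /sum_step_le0; lia.
Qed.

Lemma portion_South w i j : (i <= j <= size w)%N ->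
  height w j < height w i -> South \in drop i (take j w).
Proof.
move=> /height_portion ->; apply: contraTT => /sum_step_ge0; lia.
Qed.

Lemma mem_nth_portion w i m j : (i <= m < j)%N -> (j <= size w)%N ->
  nth North w m \in drop i (take j w).
Proof.
move=> Hm le_j; have -> : nth North w m = nth North (drop i (take j w)) (m - i).
  by rewrite nth_drop nth_take; [congr nth; lia | lia].
by rewrite mem_nth // size_drop size_takel //; lia.
Qed.

Lemma mem_portion_sub (w : walk) i i' j j' (x : step) :
  (i <= i')%N -> (j' <= j)%N -> (j <= size w)%N ->
  x \in drop i' (take j' w) -> x \in drop i (take j w).
Proof.
move=> le_i le_j le_jw /(nthP North)[m].
rewrite size_drop size_takel; last exact: leq_trans le_j le_jw.
move=> lt_m <-; rewrite nth_drop nth_take; last lia.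
by apply: mem_nth_portion; lia.
Qed.

(** A portion between two visits to one line that leaves this line in between
    goes both up and down. *)
Lemma portion_North_South w i m j : (i <= m <= j)%N -> (j <= size w)%N ->
  height w i = height w j -> height w m <> height w i ->
  (North \in drop i (take j w)) /\ (South \in drop i (take j w)).
Proof.
move=> Hm le_j Eij ne_m.
have sub_l x : x \in drop i (take m w) -> x \in drop i (take j w).
  by apply: mem_portion_sub; lia.
have sub_r x : x \in drop m (take j w) -> x \in drop i (take j w).
  by apply: mem_portion_sub; lia.
have [lt_m|gt_m|//] := ltgtP (height w m) (height w i).
  by split; [apply/sub_r/portion_North | apply/sub_l/portion_South]; lia.
by split; [apply/sub_l/portion_North | apply/sub_r/portion_South]; lia.
Qed.

(** * Consecutive opposite horizontal steps *)

Lemma self_avoiding_catl a b : self_avoiding (a ++ b) -> self_avoiding a.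
Proof.
rewrite /self_avoiding /vertices size_cat -addSn iotaD map_cat cat_uniq.
case/andP=> + _; set va := [seq _ | i <- _].
have -> // : va = [seq vertex a i | i <- iota 0 (size a).+1].
by apply/eq_in_map => i; rewrite mem_iota add0n ltnS => /= /vertex_cat_l.
Qed.

Lemma self_avoiding_no_reversal x y a b :
  self_avoiding (x ++ a :: b :: y) -> step_vec a + step_vec b <> 0.
Proof.
move=> /self_avoiding_catr; rewrite /self_avoiding /vertices /= => + E.
rewrite inE => /andP[+ _]; rewrite !inE !negb_or => /and3P[_ + _].
by rewrite /vertex /= take0 !big_cons big_nil addr0 E eqxx.
Qed.

Lemma self_avoiding_vertical x m y : self_avoiding (x ++ m ++ y) ->
  all (predC horizontal) m ->
  exists2 v : step, v \in [:: North; South] & m = nseq (size m) v.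
Proof.
elim: m x => [|a m IH] x SA /=; first by exists North; rewrite ?inE ?eqxx.
case/andP=> nh_a vert_m; have [|v _ Em] := IH (rcons x a) _ vert_m.
  by rewrite cat_rcons.
exists a; first by rewrite !inE; case: (a) nh_a; rewrite ?eqxx ?orbT.
case: (posnP (size m)) => [/size0nil -> //|].
move: Em SA vert_m; case: (size m) => // k -> SA /= /andP[nh_v _] _.
have := @self_avoiding_no_reversal x (nseq k v ++ y) a v SA.
by case: (a) nh_a; case: (v) nh_v.
Qed.

Lemma opposite_horizontal_split (w : walk) : East \in w -> West \in w ->
  exists x m y d d', [/\ w = x ++ d :: m ++ d' :: y,
    perm_eq [:: d; d'] [:: East; West] & all (predC horizontal) m].
Proof.
(* If [d] is followed by a walk [s] that contains [d'] but not [d], then the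
   steps of [s] before its first [d'] are vertical. *)
have head_case d d' (s : walk) : perm_eq [:: d; d'] [:: East; West] ->
    d \notin s -> d' \in s ->
    exists m y, s = m ++ d' :: y /\ all (predC horizontal) m.
  move=> Pdd' ds d's; exists (take (index d' s) s), (drop (index d' s).+1 s).
  split; first by rewrite -drop_index // cat_take_drop.
  apply/allP => c c_in; rewrite /= horizontalE -(perm_mem Pdd') !inE negb_or.
  apply/andP; split; first by apply: contraNneq ds => <-; apply: mem_take c_in.
  by apply/eqP => Ec; move: c_in; rewrite Ec in_take ?ltnn.
have PWE : perm_eq [:: West; East] [:: East; West].
  exact: permEl (perm_catC [:: West] _).
elim: w => // t s IH.
have [Es|nEs] := boolP (East \in s); have [Ws|nWs] := boolP (West \in s).
- have [//|//|x [m [y [d [d' [-> Pdd' Hm]]]]]] := IH.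
  by exists (t :: x), m, y, d, d'.
- rewrite !inE (negPf nWs) orbF => _ /eqP <-.
  have [m [y [-> Hm]]] := head_case _ _ s PWE nWs Es.
  by exists [::], m, y, West, East.
- rewrite !inE (negPf nEs) orbF => /eqP <- _.
  have [m [y [-> Hm]]] := head_case _ _ s (perm_refl _) nEs Ws.
  by exists [::], m, y, East, West.
- by rewrite !inE (negPf nEs) (negPf nWs) !orbF => /eqP <- /eqP.
Qed.

(** * Weakly directed irreducible bridges *)

(** A vertex strictly above all the earlier ones and not above any later one
    would split the bridge into two shorter bridges. *)
Lemma irreducible_bridge_no_cut b c : irreducible_bridge b ->
  (0 < c < size b)%N -> (forall i, (i < c)%N -> height b i < height b c) ->
  ~ (forall j, (c <= j <= size b)%N -> height b c <= height b j).
Proof.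
move=> [Bb _ irr] /andP[c0 cn] Hlt Hge; have /bridgeP[SA Hb] := Bb.
have Eb := cat_take_drop c b.
have sz1 : size (take c b) = c by rewrite size_takel ?(ltnW cn).
have sz2 : size (drop c b) = (size b - c)%N by rewrite size_drop.
have h1 i : (i <= c)%N -> height (take c b) i = height b i.
  by move=> le_i; rewrite -{2}Eb height_cat_l ?sz1.
have h2 i : height b (c + i) = height b c + height (drop c b) i.
  by have := height_cat_r (take c b) (drop c b) i; rewrite Eb sz1 h1.
apply: irr; exists (take c b), (drop c b); split=> //; first last.
- by move=> E; move: sz2; rewrite E /=; lia.
- by move=> E; move: sz1; rewrite E /=; lia.
- apply/bridgeP; split.
    by apply: (@self_avoiding_catr (take c b)); rewrite Eb.
  rewrite sz2 => i lt_i.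
  have := Hge (c + i)%N; have := Hb (c + i)%N.
  by have := h2 i; have := h2 (size b - c)%N; rewrite subnKC; lia.
apply/bridgeP; split.
  by apply: (@self_avoiding_catl _ (drop c b)); rewrite Eb.
rewrite sz1 => i lt_i; rewrite !h1 //; last exact: ltnW.
by have := Hb i; have := Hlt i; lia.
Qed.

(** In a weakly directed walk, two opposite horizontal steps between which
    the height changes are never enclosed between two visits to one line. *)
Lemma weakly_directed_no_return b d d' p q i j : weakly_directed b ->
  perm_eq [:: d; d'] [:: East; West] ->
  nth North b p = d -> nth North b q = d' ->
  height b p.+1 <> height b q ->
  (i <= p < q)%N -> (q < j <= size b)%N -> height b i <> height b j.
Proof.
move=> wd Pdd' Ep Eq ne_h Hi Hj Eij.
have [| s] := wd i j _ Eij; first by lia.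
have [N_in S_in] : North \in drop i (take j b) /\ South \in drop i (take j b).
  have [Ehp|/eqP nehp] := eqVneq (height b p.+1) (height b i).
    apply: (@portion_North_South _ _ q) => //; [lia | lia |].
    by rewrite -Ehp; apply/nesym.
  by apply: (@portion_North_South _ _ p.+1) => //; lia.
have /allP EW_in : all [in drop i (take j b)] [:: East; West].
  rewrite -(perm_all _ Pdd') /= -Ep -Eq !mem_nth_portion //; lia.
by case: s; rewrite ?N_in ?S_in ?EW_in // !inE eqxx ?orbT.
Qed.

Lemma irreducible_weakly_directed b : irreducible_bridge b ->
  weakly_directed b -> East \notin b \/ West \notin b.
Proof.
move=> irr wd; have [E_in|] := boolP (East \in b); last by left.
have [W_in|] := boolP (West \in b); [exfalso | by right].
have [/bridgeP[SA Hb] _ _] := irr.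
have [x [m [y [d [d' [Eb Pdd' vert_m]]]]]] :=
  opposite_horizontal_split E_in W_in.
have [v Hv Em] :
    exists2 v : step, v \in [:: North; South] & m = nseq (size m) v.
  apply: (@self_avoiding_vertical (rcons x d) m (d' :: y)) => //.
  by rewrite cat_rcons -Eb.
(* The step [d] goes from vertex p to vertex p.+1, the run from vertex p.+1 to
   vertex q, and the step [d'] from vertex q to vertex q.+1. *)
set p := size x; set k := size m; pose q := (p.+1 + k)%N.
have szb : size b = (q + size y).+1.
  by rewrite Eb !size_cat /= size_cat /= /q /p /k; lia.
have Ep : nth North b p = d by rewrite Eb nth_cat ltnn subnn.
have Eq : nth North b q = d'.
  rewrite Eb /q addSnnS nth_cat ltnNge leq_addr /= addKn /= nth_cat ltnn.
  by rewrite subnn.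
have [hor_d hor_d'] : (step_vec d).2 = 0 /\ (step_vec d').2 = 0.
  by case: (perm_eq_East_West Pdd') => -[-> ->].
have hp : height b p.+1 = height b p.
  by rewrite heightS ?Ep ?hor_d ?addr0 //; lia.
have hq : height b q.+1 = height b q.
  by rewrite heightS ?Eq ?hor_d' ?addr0 //; lia.
have run i : (i < k)%N -> nth North b (p.+1 + i) = v.
  move=> lt_i; rewrite Eb addSnnS nth_cat ltnNge leq_addr /= addKn /= nth_cat.
  by rewrite lt_i Em nth_nseq lt_i.
have k_gt0 : (0 < k)%N.
  rewrite lt0n; apply/eqP => k0; have := SA.
  rewrite Eb (size0nil k0) => /self_avoiding_no_reversal.
  by case: (perm_eq_East_West Pdd') => -[-> ->].
have h0 := height0 b.
have htop i : (i < size b)%N -> 0 <= height b i < height b (size b) := Hb i.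
have Hrun i : (i <= k)%N ->
    height b (p.+1 + i) = height b p + (step_vec v).2 *+ i.
  elim: i => [|i IH] le_i; first by rewrite addn0 mulr0n addr0.
  by rewrite addnS heightS ?run ?IH -?addrA -?mulrSr //; lia.
have no_return i j : (i <= p)%N -> (q < j <= size b)%N ->
    height b i <> height b j.
  move=> le_i Hj.
  apply: (weakly_directed_no_return wd Pdd' Ep Eq) => //; last lia.
  rewrite hp Hrun //; move: Hv; rewrite !inE => /orP[]/eqP -> /=; lia.
move: Hv; rewrite !inE => /orP[]/eqP Ev; last first.
  (* After a run S^k the walk climbs back to the height of vertex p. *)
  have hqp : height b q < height b p by rewrite Hrun // Ev /=; lia.
  have [||j Hj Ej] := @height_ivt b q.+1 (size b) (height b p); first lia.
    by have := htop p; lia.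
  by apply: (no_return p j) => //; lia.
have hrun i : (i <= k)%N -> height b (p.+1 + i) = height b p + i%:Z.
  by move=> /Hrun ->; rewrite Ev /=; lia.
(* [c] is least such that the vertex reached by the first [c] steps of the run
   lies above the vertices 0, ..., p. *)
pose P c := [forall i : 'I_p.+1, height b i < height b p + c%:Z].
have Pk : P k.
  (* Otherwise the height of vertex q.+1 is that of a vertex i' <= p. *)
  apply/forallP => i; rewrite ltNge; apply/negP => le_h.
  have [||i' Hi' Ei'] := @height_ivt b 0 i (height b p + k%:Z).
  - by have := ltn_ord i; lia.
  - by have := htop p; lia.
  apply: (no_return i' q.+1); [have := ltn_ord i; lia | lia |].
  by rewrite hq Ei' hrun.
have [c /forallP Pc min_c] := ex_minnP (ex_intro P k Pk).
have le_c := min_c _ Pk.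
have c_gt0 : (0 < c)%N by have /= := Pc ord_max; lia.
(* For c = 1, such an [i] is [p] itself. *)
have [i Ei] : exists i : 'I_p.+1, height b i = height b p + c%:Z - 1.
  have : ~~ P c.-1 by apply/negP => /min_c; lia.
  case/forallPn => i; rewrite -leNgt => le_h; exists i; have := Pc i; lia.
apply: (@irreducible_bridge_no_cut b (p.+1 + c) irr); first by lia.
  move=> l lt_l; rewrite hrun //; have [le_lp|lt_pl] := leqP l p.
    by have := Pc (Ordinal (le_lp : (l < p.+1)%N)).
  rewrite -(subnKC lt_pl) hrun; lia.
(* Below the cut, a later vertex would make the walk return to the height of
   vertex i. *)
move=> j Hj; rewrite hrun //; have [le_jq|lt_qj] := leqP j q.
  by rewrite -(@subnKC p.+1 j) ?hrun; lia.
rewrite leNgt; apply/negP => lt_h.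
have [||j' Hj' Ej'] := @height_ivt b j (size b) (height b i); first lia.
  by have := htop i; have := ltn_ord i; lia.
by apply: (no_return i j') => //; [have := ltn_ord i; lia | lia].
Qed.

(** * Weak directedness and factorization *)

Lemma partially_directed_portion (w : walk) i j :
  partially_directed w -> partially_directed (drop i (take j w)).
Proof.
by case=> s s_w; exists s; apply: contra s_w => /mem_drop/mem_take.
Qed.

Lemma partially_directed_weakly w : partially_directed w -> weakly_directed w.
Proof. by move=> pd i j _ _; apply: partially_directed_portion. Qed.

Lemma weakly_directed_catl a b : weakly_directed (a ++ b) -> weakly_directed a.
Proof.
move=> wd i j Hij Eh; have := wd i j.
rewrite size_cat !height_cat_l ?takel_cat; [|lia..].
by apply=> //; lia.
Qed.

Lemma portion_cat_r (a b : walk) i j :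
  drop (size a + i) (take (size a + j) (a ++ b)) = drop i (take j b).
Proof.
rewrite take_cat ltnNge leq_addr /= addKn.
by rewrite drop_cat ltnNge leq_addr /= addKn.
Qed.

Lemma weakly_directed_catr a b : weakly_directed (a ++ b) -> weakly_directed b.
Proof.
move=> wd i j Hij Eh; rewrite -(portion_cat_r a); apply: wd.
  by rewrite size_cat; lia.
by rewrite !height_cat_r Eh.
Qed.

(** Vertices of equal height lie both in [a] or both in [b]: all the vertices of
    [a] but the last are below those of [b]. *)
Lemma weakly_directed_cat a b : bridge a -> weakly_directed a ->
  (forall i, (i <= size b)%N -> 0 <= height b i) -> weakly_directed b ->
  weakly_directed (a ++ b).
Proof.
move=> /bridgeP[_ Ha] wda Hb wdb i j; rewrite size_cat => Hij.
have [le_ja|lt_aj] := leqP j (size a).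
  rewrite !height_cat_l ?takel_cat; [|lia..]; move=> Eh; apply: wda => //; lia.
have Ej := subnKC (ltnW lt_aj); rewrite -Ej height_cat_r.
have [lt_ia|le_ai] := ltnP i (size a).
  rewrite height_cat_l ?(ltnW lt_ia) //.
  by have := Ha i; have := Hb (j - size a)%N; lia.
rewrite -(subnKC le_ai) height_cat_r portion_cat_r => /addrI Eh.
by apply: wdb => //; lia.
Qed.

Lemma weakly_directed_flatten bs : (forall b, b \in bs -> bridge b) ->
  (forall b, b \in bs -> weakly_directed b) -> weakly_directed (flatten bs).
Proof.
elim: bs => [|b bs IH] br wd; first by move=> i j /=; lia.
have br' c : c \in bs -> bridge c.
  by move=> c_in; apply: br; rewrite inE c_in orbT.
apply: weakly_directed_cat; [exact/br/mem_head | exact/wd/mem_head | |].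
  by move=> i; apply: height_flatten_ge0.
by apply: IH => // c c_in; apply: wd; rewrite inE c_in orbT.
Qed.

Lemma weakly_directed_factor bs b :
  weakly_directed (flatten bs) -> b \in bs -> weakly_directed b.
Proof.
move=> + b_in; case/splitPr: b_in => bs1 bs2; rewrite flatten_cat /=.
by move/weakly_directed_catr/weakly_directed_catl.
Qed.

Lemma NES_or_NSW b : self_avoiding b -> East \notin b \/ West \notin b ->
  NES_walk b \/ NSW_walk b.
Proof.
move=> SA [nE|nW]; [right | left]; rewrite /NES_walk /NSW_walk /walk_over SA;
  apply/allP => -[] c_in; rewrite !inE ?eqxx ?orbT //=.
- by rewrite c_in in nE.
- by rewrite c_in in nW.
Qed.

Lemma NES_NSW_partially_directed b :
  NES_walk b \/ NSW_walk b -> partially_directed b.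
Proof.
by case=> /andP[_ /allP Hb]; [exists West | exists East];
  apply/negP => /Hb; rewrite !inE => /or3P[]/eqP.
Qed.

Theorem proposition2 (w : walk) (bs : seq walk)
  (w_bridge : bridge w) (bs_fact : irreducible_factorization w bs) :
  (weakly_directed w <->
     (forall b : walk, b \in bs -> partially_directed b)) /\
  ((forall b : walk, b \in bs -> partially_directed b) <->
     (forall b : walk, b \in bs -> NES_walk b \/ NSW_walk b)).
Proof.
case: bs_fact => irr Ew.
have br b : b \in bs -> bridge b by case/irr.
have NES_NSW b : b \in bs -> weakly_directed b -> NES_walk b \/ NSW_walk b.
  move=> b_in wd; apply: NES_or_NSW; first by case/bridgeP: (br b b_in).
  exact: irreducible_weakly_directed (irr b b_in) wd.
split; split=> H.
- move=> b b_in; apply/NES_NSW_partially_directed/NES_NSW => //.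
  by apply: weakly_directed_factor b_in; rewrite Ew.
- rewrite -Ew; apply: weakly_directed_flatten => // b b_in.
  exact/partially_directed_weakly/H.
- by move=> b b_in; apply: NES_NSW => //; apply/partially_directed_weakly/H.
- by move=> b b_in; apply/NES_NSW_partially_directed/H.
Qed.
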